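(* Let $X$ and $Y$ be real-valued random variables with finite expectation and $\mathbb{E}[X] > \mathbb{E}[Y]$. For every $\varepsilon \in (0,1)$ there are a $\sigma^2 > 0$ and a distribution on $\mathbb{R}$ with cumulative distribution function $H$ such that, if $G$ is the cumulative distribution function of the Gaussian distribution with zero mean and variance $\sigma^2$, and if $Z$ is a random variable independent of $X$ and $Y$ with cumulative distribution function $$F_Z = (1-\varepsilon) G + \varepsilon H,$$ then $$X + Z >_1 Y + Z.$$
   Context: For real random variables $X,Y$, write $X \geq_1 Y$ if $\mathbb{E}[\phi(X)] \geq \mathbb{E}[\phi(Y)]$ for every increasing (i.e. non-decreasing) function $\phi:\mathbb{R}\to\mathbb{R}$ for which the two expectations are well defined; equivalently, $F_X(t)\le F_Y(t)$ for all $t$. Write $X >_1 Y$ if $X \geq_1 Y$ and $X$ and $Y$ have distinct distributions. *)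

(* Defs.v *)
From HB Require Import structures.
From mathcomp Require Import all_boot all_order all_algebra.
From mathcomp Require Import all_classical all_reals all_analysis.
From mathcomp Require Import measurable_realfun.
Import Order.TTheory GRing.Theory Num.Theory.

Set Implicit Arguments.
Unset Strict Implicit.
Unset Printing Implicit Defensive.

Local Open Scope classical_set_scope.
Local Open Scope ring_scope.

Section stochastic_dominance.
Context d (T : measurableType d) (R : realType) (P : probability T R).

(* The expectation of f exists in [-oo, +oo]: it is not of the form oo - oo.
   The library integral is total, so this has to be required explicitly. *)
Definition has_expectation (f : T -> R) : Prop :=
  (\int[P]_w (EFin \o f)^\+ w < +oo)%E \/ (\int[P]_w (EFin \o f)^\- w < +oo)%E.

Definition stoch_ge (X Y : {RV P >-> R}) : Prop :=
  forall phi : R -> R, {homo phi : x y / x <= y} ->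
    has_expectation (phi \o X) -> has_expectation (phi \o Y) ->
    ('E_P[phi \o Y] <= 'E_P[phi \o X])%E.

(* Two laws are compared on measurable sets only: the value of a measure on
   other sets carries no information. *)
Definition same_distribution (X Y : {RV P >-> R}) : Prop :=
  forall A : set R, measurable A -> distribution P X A = distribution P Y A.

Definition stoch_gt (X Y : {RV P >-> R}) : Prop :=
  stoch_ge X Y /\ ~ same_distribution X Y.

Definition independent_RV (X Y : {RV P >-> R}) : Prop :=
  forall A B : set R, measurable A -> measurable B ->
    P (X @^-1` A `&` Y @^-1` B) = (P (X @^-1` A) * P (Y @^-1` B))%E.

End stochastic_dominance.
Arguments stoch_ge {d T R} P X Y.
Arguments same_distribution {d T R} P X Y.
Arguments stoch_gt {d T R} P X Y.
Arguments independent_RV {d T R} P X Y.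

Section extension.
Context d d' (T : measurableType d) (T' : measurableType d') (R : realType).
Context (P : probability T R) (P' : probability T' R).

(* A measure-preserving map theta : T' -> T makes (T', P') an extension of
   (T, P). The original space need not carry a non-trivial random variable
   independent of the given ones; an extension such as a product space does. *)
Definition measure_preserving (theta : {mfun T' >-> T}) : Prop :=
  forall A : set T, measurable A -> P' (theta @^-1` A) = P A.

End extension.
Arguments measure_preserving {d d' T T' R} P P' theta.

(* Main.v *)
(** The cdf of X + Z at t is E[F(t - X)], where F is the cdf of Z. So it suffices
    to find a density p for Z such that the expectation of the integral of p
    from t - X to t - Y is positive for every t. Let W = |X| + |Y|.
    - If p varies by a factor at most 1 +- k on the intervals of radius A, the
      event W < A contributes p(t) E[X - Y] up to the error k p(t) E[W].
    - If p(t - u) <= C p(t) for |u| <= |t|/2, the event A <= W < |t|/2 costs at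
      most C p(t) E[W; A <= W].
    - The event A <= W, |t|/2 <= W costs at most its probability, so the density
      p has to dominate this tail of W: P(A <= W, |t|/2 <= W) <= k p(t).
    The kernel (w / (w + |x|))^2 satisfies the first two conditions at scale w,
    and at scale B it dominates the Gaussian density of standard deviation B
    together with its variation on intervals of length bB. The distribution H
    is a mixture, over the law of W, of these kernels at scale B + W, with an
    additional weight M B on the event A <= W, where A = b B. This weight yields
    the third condition, and since E[W; bB <= W] tends to 0 as B grows, it does
    not change the order of the total mass, which is B. *)

Require Import Defs.
From HB Require Import structures.
From mathcomp Require Import all_boot all_order all_algebra.
From mathcomp Require Import all_classical all_reals all_analysis.
From mathcomp Require Import measurable_realfun ring lra.
Import Order.TTheory GRing.Theory Num.Theory.
Import numFieldNormedType.Exports.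
Local Open Scope classical_set_scope.
Local Open Scope ring_scope.

(** * Heavy-tailed kernel and Gaussian density *)

Section kernel.
Context {R : realType}.
Implicit Types w x u b : R.

(** An unnormalised bump of height 1 and width [w]. The inverse-square tail is light enough to be
    integrable and heavy enough for a shift by [|x| / 2] to cost only a constant factor. *)
Definition heavy_kernel w x : R := (w / (w + `|x|)) ^+ 2.

Lemma heavy_kernel_gt0 w x : 0 < w -> 0 < heavy_kernel w x.
Proof.
by move=> w0; rewrite exprn_gt0// divr_gt0// ltr_pwDl.
Qed.

Lemma heavy_kernel_le1 w x : 0 < w -> heavy_kernel w x <= 1.
Proof.
move=> w0; have wx : 0 < w + `|x| by rewrite ltr_pwDl.
rewrite exprn_ile1//; first by rewrite ltW// divr_gt0.
by rewrite ler_pdivrMr// mul1r lerDl.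
Qed.

Lemma le_heavy_kernel w w' x : 0 < w -> w <= w' ->
  heavy_kernel w x <= heavy_kernel w' x.
Proof.
move=> w0 ww'; have w'0 := lt_le_trans w0 ww'.
have wx : 0 < w + `|x| by rewrite ltr_pwDl.
have wx' : 0 < w' + `|x| by rewrite ltr_pwDl.
rewrite lerXn2r// ?nnegrE; [by rewrite ltW// divr_gt0..|].
rewrite ler_pdivrMr// mulrAC ler_pdivlMr// !mulrDr mulrC lerD2l.
by rewrite ler_wpM2r.
Qed.

(** Source of the shift estimates below: a comparison of denominators by a factor [r] is squared. *)
Lemma heavy_kernel_ratio w x y r : 0 < w -> 0 <= r ->
  w + `|x| <= r * (w + `|y|) -> heavy_kernel w y <= r ^+ 2 * heavy_kernel w x.
Proof.
move=> w0 r0 h; rewrite /heavy_kernel -exprMn.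
have wx : 0 < w + `|x| by rewrite ltr_pwDl.
have wy : 0 < w + `|y| by rewrite ltr_pwDl.
rewrite lerXn2r// ?nnegrE; first by rewrite ltW// divr_gt0.
  by rewrite mulr_ge0// ltW// divr_gt0.
rewrite ler_pdivrMr// (_ : r * _ * _ = w * (r * (w + `|y|)) / (w + `|x|)).
  by rewrite ler_pdivlMr// ler_wpM2l// ltW.
by ring.
Qed.

(** Here [|x - u|] is at least [|x| / 2], so the denominators compare with ratio 2. *)
Lemma heavy_kernel_half w x u : 0 < w -> `|u| <= `|x| / 2 ->
  heavy_kernel w (x - u) <= 4 * heavy_kernel w x.
Proof.
move=> w0 ux; rewrite (_ : 4 = 2 ^+ 2 :> R); last by lra.
apply: heavy_kernel_ratio => //.
have := lerB_dist x u; lra.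
Qed.

(** The shift changes the denominator by at most [b * w], so the ratio is at most [1 + b] in both
    directions, and [(1 + b) ^+ 2 <= 1 + 3 * b] for [b] in the unit interval. *)
Lemma heavy_kernel_near w x u b : 0 < w -> 0 <= b -> b <= 1 ->
  `|u| <= b * w ->
  `|heavy_kernel w (x - u) - heavy_kernel w x| <= 3 * b * heavy_kernel w x.
Proof.
move=> w0 b0 b1 ubw.
have K0 := heavy_kernel_gt0 _ x w0.
have K0' := heavy_kernel_gt0 _ (x - u) w0.
have h1 : heavy_kernel w (x - u) <= (1 + b) ^+ 2 * heavy_kernel w x.
  apply: heavy_kernel_ratio => //; first lra.
  have h : `|x| <= `|x - u| + `|u| by rewrite -{1}(subrK u x) ler_normD.
  have := normr_ge0 (x - u); nra.
have h2 : heavy_kernel w x <= (1 + b) ^+ 2 * heavy_kernel w (x - u).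
  apply: heavy_kernel_ratio => //; first lra.
  have h : `|x - u| <= `|x| + `|u| by rewrite ler_normB.
  have := normr_ge0 x; nra.
have b2 : (1 + b) ^+ 2 <= 1 + 3 * b by nra.
rewrite ler_norml; apply/andP; split; nra.
Qed.

Lemma heavy_kernel_far w x : 0 < w -> `|x| <= 2 * w ->
  1 / 9 <= heavy_kernel w x.
Proof.
move=> w0 xw; rewrite (_ : 1 / 9 = 3^-1 ^+ 2 :> R); last first.
  by rewrite exprVn div1r; congr (_^-1); lra.
have wx : 0 < w + `|x| by rewrite ltr_pwDl.
rewrite lerXn2r ?nnegrE//; first by rewrite ltW// divr_gt0.
rewrite ler_pdivlMr// ler_pdivrMl//; lra.
Qed.

End kernel.

(** * Gaussian decay and variation under small shifts, measured by the kernel *)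

Section gauss.
Context {R : realType}.
Implicit Types s x y z v u b : R.

(** It suffices to bound [(1 + z) ^+ 2] by [5 * expR (z ^+ 2 / 4)] and to square. By the tangent
    bound for [expR] this follows from [5 * (1 + z ^+ 2 / 4) - (1 + z) ^+ 2 = (2 - z / 2) ^+ 2]. *)
Lemma expR_quartic z : 0 <= z -> (1 + z) ^+ 4 * expR (- (z ^+ 2 / 2)) <= 25.
Proof.
move=> z0.
have h1 : 1 + z ^+ 2 / 4 <= expR (z ^+ 2 / 4) by exact: expR_ge1Dx.
have h2 : (1 + z) ^+ 2 <= 5 * expR (z ^+ 2 / 4).
  have : 0 <= (2 - z / 2) ^+ 2 by exact: sqr_ge0.
  by nra.
have -> : - (z ^+ 2 / 2) = - (z ^+ 2 / 4) - (z ^+ 2 / 4) by lra.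
rewrite expRD expRN.
have E0 := expR_gt0 (z ^+ 2 / 4).
rewrite -invfM ler_pdivrMr; last by nra.
have : 0 <= (1 + z) ^+ 2 by exact: sqr_ge0.
rewrite (_ : (1 + z) ^+ 4 = (1 + z) ^+ 2 * (1 + z) ^+ 2); last by rewrite -exprD.
nra.
Qed.

Let e x : R := expR (- (x ^+ 2 / 2)).

Lemma gauss_decay x : (1 + `|x|) ^+ 2 * e x <= 25.
Proof.
rewrite /e -(real_normK (num_real x)); apply: le_trans (expR_quartic _ (normr_ge0 x)).
by rewrite ler_wpM2r ?expR_ge0// ler_weXn2l ?lerDl.
Qed.

(** The shift moves away from the origin, so the difference has a known sign. The tangent bound for
    [expR] makes it at most [e x] times the change of exponent, itself at most [b * (1 + |x|)].
    Three powers of [1 + |x|] then appear, and [expR_quartic] absorbs them. *)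
Lemma gauss_diff_le x v b : 0 <= b -> b <= 1 -> `|v| <= b -> `|x| <= `|x - v| ->
  `|e (x - v) - e x| * (1 + `|x|) ^+ 2 <= 25 * b.
Proof.
move=> b0 b1 vb xv.
have h1 : e (x - v) <= e x.
  rewrite /e ler_expR lerN2 ler_wpM2r// -(real_normK (num_real x)).
  rewrite -[leRHS](real_normK (num_real _)) lerXn2r// nnegrE//.
have h2 : e x * (1 + (x ^+ 2 / 2 - (x - v) ^+ 2 / 2)) <= e (x - v).
  rewrite /e [in leRHS](_ : - ((x - v) ^+ 2 / 2) =
    - (x ^+ 2 / 2) + (x ^+ 2 / 2 - (x - v) ^+ 2 / 2)); last by lra.
  by rewrite [leRHS]expRD ler_wpM2l ?expR_ge0// expR_ge1Dx.
rewrite distrC ger0_norm ?subr_ge0//.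
have h3 : (x - v) ^+ 2 / 2 - x ^+ 2 / 2 <= b * (1 + `|x|).
  have -> : (x - v) ^+ 2 / 2 - x ^+ 2 / 2 = - (x * v) + v ^+ 2 / 2 by lra.
  have : - (x * v) <= `|x| * `|v| by rewrite -normrM -normrN ler_norm.
  have : v ^+ 2 <= b.
    rewrite -(real_normK (num_real v)); have := normr_ge0 v; nra.
  have := normr_ge0 x; have := normr_ge0 v; nra.
have e0 : 0 <= e x by exact: expR_ge0.
have h4 : e x - e (x - v) <= e x * (b * (1 + `|x|)) by nra.
have h5 := expR_quartic _ (normr_ge0 x).
rewrite (real_normK (num_real x)) -/(e x) in h5.
have x0 := normr_ge0 x.
apply: (@le_trans _ _ (e x * (b * (1 + `|x|)) * (1 + `|x|) ^+ 2)).
  by rewrite ler_wpM2r// sqr_ge0.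
apply: (@le_trans _ _ (b * ((1 + `|x|) ^+ 4 * e x))); last by rewrite mulrC ler_wpM2r.
rewrite (_ : e x * _ * _ = b * ((1 + `|x|) ^+ 3 * e x)); last by ring.
by rewrite ler_wpM2l// ler_wpM2r// ler_weXn2l ?lerDl.
Qed.

Lemma gauss_diff x v b : 0 <= b -> b <= 1 -> `|v| <= b ->
  `|e (x - v) - e x| * (1 + `|x|) ^+ 2 <= 100 * b.
Proof.
move=> b0 b1 vb; have [xv|xv] := leP `|x| `|x - v|.
  apply: le_trans (gauss_diff_le _ _ _ b0 b1 vb xv) _; lra.
(* If the shift moves towards the origin, the roles of [x] and [x - v] are exchanged. Since
   [|v| <= 1], the weight changes by at most [2 ^+ 2], whence the constant [100 = 4 * 25]. *)
have := gauss_diff_le (x - v) (- v) b b0 b1.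
rewrite normrN opprK subrK => /(_ vb (ltW xv)).
rewrite distrC => h.
apply: (@le_trans _ _ (4 * (`|e (x - v) - e x| * (1 + `|x - v|) ^+ 2))); last by lra.
rewrite [leRHS]mulrCA ler_wpM2l//.
rewrite (_ : 4 = 2 ^+ 2 :> R); last by lra.
rewrite -exprMn lerXn2r ?nnegrE ?mulr_ge0 ?addr_ge0//.
have : `|x| <= `|x - v| + `|v| by rewrite -{1}(subrK v x) ler_normD.
have := normr_ge0 (x - v); lra.
Qed.

Lemma normal_pdf_scale s x : 0 < s ->
  normal_pdf 0 s x = normal_peak s * e (x / s).
Proof.
move=> s0; rewrite normal_pdfE ?gt_eqF//; congr (_ * expR _).
by rewrite subr0; field; exact: lt0r_neq0.
Qed.

Lemma normal_peak_le s : 0 < s -> normal_peak s <= s^-1.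
Proof.
move=> s0; rewrite /normal_peak lef_pV2 ?posrE// ?sqrtr_gt0; last first.
  by rewrite mulrn_wgt0// mulr_gt0 ?pi_gt0// exprn_gt0.
rewrite -{1}(ger0_norm (ltW s0)) -sqrtr_sqr ler_wsqrtr//.
have := pi_ge2 R; have : 0 < s ^+ 2 by rewrite exprn_gt0.
rewrite -mulr_natr; nra.
Qed.

(** The kernel is the inverse of the weight in [gauss_decay] and [gauss_diff]; this turns those
    weighted bounds into bounds by the kernel. *)
Lemma heavy_kernel_scale s x : 0 < s ->
  heavy_kernel s x * (1 + `|x / s|) ^+ 2 = 1.
Proof.
move=> s0; have sx : 0 < s + `|x| by rewrite ltr_pwDl.
rewrite /heavy_kernel -exprMn normrM normfV (gtr0_norm s0).
rewrite (_ : _ * _ = 1) ?expr1n//; field.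
by rewrite !gt_eqF.
Qed.

Lemma normal_pdf_decay s x : 0 < s ->
  normal_pdf 0 s x <= 25 / s * heavy_kernel s x.
Proof.
move=> s0; rewrite normal_pdf_scale//.
have K0 := heavy_kernel_gt0 _ x s0; have Ks := heavy_kernel_scale _ x s0.
have := gauss_decay (x / s); have := normal_peak_le _ s0.
have s1 : 0 < s^-1 by rewrite invr_gt0.
have := @normal_peak_ge0 _ s.
set N := normal_peak _; set E := e _; set k := heavy_kernel _ _ in K0 Ks *.
set j := (1 + _) ^+ 2 in Ks * => N0 N1 h.
have hE : E <= 25 * k.
  have -> : E = j * E * k by rewrite mulrAC (mulrC j) Ks mul1r.
  by rewrite ler_wpM2r// ltW.
have E0 : 0 <= E by exact: expR_ge0.
apply: (@le_trans _ _ (s^-1 * E)); first by rewrite ler_wpM2r.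
by rewrite (mulrC _ s^-1) -mulrA ler_wpM2l// ltW.
Qed.

Lemma normal_pdf_near s x u b : 0 < s -> 0 <= b -> b <= 1 -> `|u| <= b * s ->
  `|normal_pdf 0 s (x - u) - normal_pdf 0 s x| <= 100 * b / s * heavy_kernel s x.
Proof.
move=> s0 b0 b1 ub; rewrite !normal_pdf_scale// mulrBl -mulrBr normrM.
have K0 := heavy_kernel_gt0 _ x s0; have Ks := heavy_kernel_scale _ x s0.
have := gauss_diff (x / s) (u / s) b b0 b1.
rewrite normrM normfV (gtr0_norm s0) ler_pdivrMr// => /(_ ub).
have := normal_peak_le _ s0.
have s1 : 0 < s^-1 by rewrite invr_gt0.
rewrite (ger0_norm (normal_peak_ge0 s)).
have := @normal_peak_ge0 _ s.
rewrite normrM normfV (gtr0_norm s0) in Ks.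
set N := normal_peak _; set E := `|e _ - e _|; set k := heavy_kernel _ _ in K0 Ks *.
rewrite normrM normfV (gtr0_norm s0).
set j := (1 + _) ^+ 2 in Ks * => N0 N1 h.
have hE : E <= 100 * b * k.
  have -> : E = E * j * k by rewrite -mulrA (mulrC j) Ks mulr1.
  by rewrite ler_wpM2r// ltW.
have E0 : 0 <= E by exact: normr_ge0.
apply: (@le_trans _ _ (s^-1 * E)); first by rewrite ler_wpM2r.
by rewrite (mulrC _ s^-1) -mulrA ler_wpM2l// ltW.
Qed.

End gauss.

(** * Measurability and total mass of the kernel *)

Section kernel_integral.
Context {R : realType}.
Implicit Types w x : R.
Let mu := @lebesgue_measure R.

Lemma continuous_heavy_kernel w : 0 < w -> continuous (heavy_kernel w).
Proof.
move=> w0 x; rewrite /heavy_kernel.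
apply: (@continuous_comp _ _ _ (fun x => w / (w + `|x|)) (fun y => y ^+ 2));
  last exact: exprn_continuous.
apply: continuousM; first exact: cst_continuous.
apply: continuousV; first by rewrite gt_eqF// ltr_pwDl.
apply: continuousD; first exact: cst_continuous.
exact: norm_continuous.
Qed.

Lemma measurable_fun_inv_gt0 {d} {T : measurableType d} (f : T -> R) :
  (forall t, 0 < f t) -> measurable_fun setT f ->
  measurable_fun setT (fun t => (f t)^-1).
Proof.
move=> f0 mf; apply: (eq_measurable_fun (fun t => f t `^ (-1))).
  by move=> t _; rewrite powR_inv1// ltW.
exact: (measurableT_comp (@measurable_powR R (-1))).
Qed.

Lemma measurable_heavy_kernel {d} {T : measurableType d} (f g : T -> R) :
  (forall t, 0 < f t) -> measurable_fun setT f -> measurable_fun setT g ->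
  measurable_fun setT (fun t => heavy_kernel (f t) (g t)).
Proof.
move=> f0 mf mg; apply: measurable_funX; apply: measurable_funM => //.
apply: measurable_fun_inv_gt0; first by move=> t; rewrite ltr_pwDl.
by apply: measurable_funD => //; exact: measurableT_comp.
Qed.

(** By symmetry this is twice the integral over the positive half-line, where
    [- (w ^+ 2 * (w + x)^-1)] is an antiderivative that rises from [- w] to 0. *)
Lemma integral_heavy_kernel w : 0 < w ->
  (\int[mu]_x (heavy_kernel w x)%:E = (2 * w)%:E)%E.
Proof.
move=> w0; have ck := continuous_heavy_kernel w w0.
have wx x : 0 < x -> w + x != 0 by move=> x0; rewrite gt_eqF// addr_gt0.
have dF x : 0 < x ->
    is_derive x 1 (fun x => - (w ^+ 2 * (w + x)^-1)) (heavy_kernel w x).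
  move=> x0; have dV : is_derive x 1 (fun x => (w + x)^-1) (- (w + x) ^- 2 *: 1).
    apply: (is_deriveV (f := fun x => w + x)); first exact: wx.
    have := @is_deriveD _ _ _ (cst w) id x 1 0 1 (is_derive_cst _ _ _) (is_derive_id _ _).
    by rewrite add0r.
  apply: is_derive_eq; rewrite /heavy_kernel gtr0_norm//.
  rewrite /GRing.scale/= ?mulr1 ?mulr0 ?addr0.
  by field; exact: wx.
rewrite ge0_symfun_integralT//.
- pose F x : R := - (w ^+ 2 * (w + x)^-1).
  rewrite -set_itvcy (@ge0_continuous_FTC2y _ _ F 0 0).
  + by rewrite /F addr0 expr2 mulfK ?gt_eqF// EFinN oppeK add0e -EFinM.
  + by move=> x _; exact/ltW/heavy_kernel_gt0.
  + exact: continuous_subspaceT.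
  + rewrite -oppr0 -(mulr0 (w ^+ 2)); apply: cvgN; apply: cvgMr => //.
    apply/(@gtr0_cvgV0 R R (pinfty_nbhs R) _ (fun x => w + x)).
      by near do rewrite addr_gt0//.
    exact: cvg_addrl.
  + by move=> x x0; have [] := dF x x0.
  + apply: cvg_at_right_filter; apply: cvgN; apply: cvgMr.
    apply: cvgV; first by rewrite addr0 gt_eqF.
    by apply: cvgD; [exact: cvg_cst|exact: cvg_id].
  + move=> x; rewrite in_itv/= andbT => x0.
    by rewrite derive1E; have [_ ->] := dF x x0.
- by move=> x; exact/ltW/heavy_kernel_gt0.
- by move=> x; rewrite /heavy_kernel/= normrN.
Unshelve. all: by end_near. Qed.
End kernel_integral.

(** * Probabilities with a density, stochastic order, independent sums *)

Section density.
Context {R : realType} (f : R -> R).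
Hypotheses (mf : measurable_fun setT f) (f0 : forall x, 0 <= f x)
  (f1 : (\int[lebesgue_measure]_x (f x)%:E = 1)%E).

Let density (A : set (measurableTypeR R)) : \bar R :=
  (\int[lebesgue_measure]_(x in A) (f x)%:E)%E.

Let density0 : density set0 = 0%E.
Proof. by rewrite /density integral_set0. Qed.

Let density_ge0 A : (0 <= density A)%E.
Proof. by apply: integral_ge0 => x _; rewrite lee_fin. Qed.

Let density_sigma_additive : semi_sigma_additive density.
Proof.
move=> F mF tF mUF; rewrite /density; apply: cvg_toP.
  apply: ereal_nondecreasing_is_cvgn => m n mn.
  apply: lee_sum_nneg_natr => // k _ _; apply: integral_ge0 => /= x _.
  by rewrite lee_fin.
rewrite ge0_integral_bigcup//=.
- by apply/measurable_funTS/measurable_EFinP.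
- by move=> x _; rewrite lee_fin.
Qed.

HB.instance Definition _ := isMeasure.Build _ _ _
  density density0 density_ge0 density_sigma_additive.

HB.instance Definition _ :=
  @Measure_isProbability.Build _ _ R density f1.

Lemma density_probability : exists H : probability (measurableTypeR R) R,
  forall A, H A = (\int[lebesgue_measure]_(x in A) (f x)%:E)%E.
Proof. by exists density. Qed.

End density.

(** * Stochastic dominance from the comparison of cdfs *)

Section dominance.
Context {d} {T : measurableType d} {R : realType} {P : probability T R}.
Implicit Types U V : {RV P >-> R}.

(** Layer-cake formula: the expectation of a nonnegative variable is the integral of its tail
    probabilities. *)
Lemma ge0_integral_le_tail (f g : T -> R) :
  measurable_fun setT f -> measurable_fun setT g ->
  (forall w, 0 <= f w) -> (forall w, 0 <= g w) ->
  (forall t, P [set w | (t < f w)%R] <= P [set w | (t < g w)%R])%E ->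
  (\int[P]_w (f w)%:E <= \int[P]_w (g w)%:E)%E.
Proof.
move=> mf mg f0 g0 fg.
pose F : {RV P >-> R} := mfun_Sub (mem_set mf).
pose G : {RV P >-> R} := mfun_Sub (mem_set mg).
have tail (h : T -> R) t : h @^-1` `]t, +oo[ = [set w | t < h w].
  by apply/seteqP; split => w /=; rewrite in_itv/= andbT.
suff : ('E_P[F] <= 'E_P[G])%E by rewrite !unlock.
rewrite !ge0_expectation_ccdf//; apply: ge0_le_integral => //=.
- by apply: measurable_funTS; exact: ccdf_measurable.
- by apply: measurable_funTS; exact: ccdf_measurable.
- by move=> t _; rewrite /ccdf /distribution /pushforward/= !tail.
Qed.

(** An up-closed set of reals is empty, the whole line, or a half-line, open or closed, starting at
    its infimum. Open half-lines are complements of those that define the cdf; the closed case is a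
    limit of open ones. *)
Lemma cdf_le_upper_set U V (S : set R) : (forall t, cdf U t <= cdf V t)%E ->
  (forall x y, x <= y -> S x -> S y) ->
  (P (V @^-1` S) <= P (U @^-1` S))%E.
Proof.
move=> UV Sup.
have ccdfVU t : (distribution P V `]t, +oo[ <= distribution P U `]t, +oo[)%E.
  by have := ccdf_1_cdf U t; have := ccdf_1_cdf V t; rewrite /ccdf => -> ->; rewrite leeB.
have mS : measurable S.
  apply: is_interval_measurable => x y Sx Sy z /andP[xz zy].
  exact: Sup xz Sx.
have [->|/set0P Sn] := eqVneq S set0; first by rewrite !preimage_set0 !measure0.
have [->|/setTPn[z0 Sz0]] := eqVneq S setT; first by rewrite !preimage_setT.
have Slb z : S z -> z0 <= z.
  by move=> Sz; rewrite leNgt; apply/negP => /ltW zz0; apply: Sz0; exact: Sup zz0 Sz.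
have hS : has_inf S by split => //; exists z0 => z; exact: Slb.
have Sgt t : inf S < t -> S t.
  move=> /(inf_lt hS.1)[z Sz zt]; exact: Sup (ltW zt) Sz.
have [Si|Si] := pselect (S (inf S)).
  (* The infimum is attained, so [S] is a closed half-line, the decreasing intersection of open
     half-lines; continuity from above transfers the inequality. *)
  have SE : S = \bigcap_n `]inf S - n.+1%:R^-1, +oo[%classic.
    apply/seteqP; split => [x Sx n _|x h].
      rewrite /= in_itv/= andbT (lt_le_trans _ (ge_inf hS.2 Sx))//.
      by rewrite ltrBlDr ltrDl invr_gt0.
    apply: (Sup (inf S)) => //; apply/ler_addgt0Pr => e e0.
    have [n ne] := ltr_add_invr (y := 0) (x := e) e0.
    have := h n I; rewrite /= in_itv/= andbT => h1.
    by rewrite -lerBlDr (le_trans _ (ltW h1))// lerB// ltW// -[ltLHS]add0r.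
  have cv W : distribution P W `]inf S - n.+1%:R^-1, +oo[%classic @[n --> \oo]
      --> distribution P W S.
    rewrite {2}SE; apply: nonincreasing_cvg_mu => //.
    - by rewrite ltey_eq fin_num_measure.
    - by apply: bigcapT_measurable.
    - apply/nonincreasing_seqP => n; apply/subsetPset => x /=.
      rewrite !in_itv/= !andbT; apply: le_lt_trans.
      by rewrite lerB// lef_pV2 ?posrE// ler_nat.
  apply: (@lee_cvg_to _ _ _ _ _ _
    (distribution P V S) (distribution P U S) (cv V) (cv U)).
  by near=> n.
suff -> : S = `]inf S, +oo[%classic by exact: ccdfVU.
apply/seteqP; split => [x Sx|x] /=; rewrite in_itv/= andbT.
  rewrite lt_neqAle (ge_inf hS.2 Sx) andbT; apply/eqP => h; apply: Si.
  by rewrite h.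
exact: Sgt.
Unshelve. all: by end_near. Qed.

(** The positive and negative parts of [phi] are compared separately through their tails, and the
    two inequalities are then subtracted. *)
Lemma cdf_le_stoch_ge U V : (forall t, cdf U t <= cdf V t)%E -> stoch_ge P U V.
Proof.
move=> UV phi phi_nd _ _.
have mphi : measurable_fun setT phi by exact: nondecreasing_measurable.
have mU : measurable_fun setT (phi \o U) by exact: measurableT_comp.
have mV : measurable_fun setT (phi \o V) by exact: measurableT_comp.
have le_pos : (\int[P]_w ((phi \o V)^\+ w)%:E <= \int[P]_w ((phi \o U)^\+ w)%:E)%E.
  apply: ge0_integral_le_tail; [exact: measurable_funrpos..| | |] => //.
  move=> t; apply: (cdf_le_upper_set _ _ [set x | t < Num.max (phi x) 0] UV).
  move=> x y xy /=; rewrite !lt_max => /orP[tx|->]; last by rewrite orbT.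
  by rewrite (lt_le_trans tx)// phi_nd.
have le_neg : (\int[P]_w ((phi \o U)^\- w)%:E <= \int[P]_w ((phi \o V)^\- w)%:E)%E.
  apply: ge0_integral_le_tail; [exact: measurable_funrneg..| | |] => //.
  move=> t.
  (* The tail events of the negative part come from down-closed sets, so the comparison is made on
     the up-closed complement. *)
  pose S := [set x | Num.max (- phi x) 0 <= t].
  have Sup x y : x <= y -> S x -> S y.
    move=> xy; rewrite /S/= !ge_max => /andP[tx ->]; rewrite andbT.
    by rewrite (le_trans _ tx)// lerN2 phi_nd.
  have mS : measurable S.
    apply: is_interval_measurable => x y Sx Sy z /andP[xz _]; exact: Sup xz Sx.
  have SE W : [set w | t < (phi \o W)^\- w] = ~` (W @^-1` S) :> set T.
    apply/seteqP; split => w /=; first by move=> h; apply/negP; rewrite -ltNge.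
    by move=> /negP; rewrite -ltNge.
  rewrite !SE !probability_setC; [|exact: measurable_funPTI..].
  by apply: leeB => //; exact: cdf_le_upper_set.
rewrite !unlock [leLHS]integralE [leRHS]integralE.
apply: leeB.
  by rewrite (funerpos (phi \o V)) (funerpos (phi \o U)).
by rewrite (funerneg (phi \o V)) (funerneg (phi \o U)).
Qed.

End dominance.

(** * The cdf of an independent sum as a convolution *)

Section independent_sum.
Context {d} {T : measurableType d} {R : realType} {P : probability T R}.
Implicit Types X Z : {RV P >-> R}.

Lemma cdf_independent_add X Z t : independent_RV P Z X ->
  cdf (X \+ Z : {RV P >-> R}) t = (\int[P]_w cdf Z (t - X w))%E.
Proof.
move=> ZX.
pose m1 := distribution P X.
pose m2 := distribution P Z.
have mXZ : measurable_fun setT (fun w => (X w, Z w) : R * R).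
  exact: measurable_fun_pair.
pose XZ : {mfun T >-> (R * R)%type} := mfun_Sub (mem_set mXZ).
have mA : measurable [set z : R * R | z.1 + z.2 <= t].
  have : measurable_fun setT (fun z : R * R => z.1 + z.2 <= t).
    by apply: measurable_fun_ler => //; apply: measurable_funD.
  by move=> /(_ measurableT [set true]); rewrite setTI; exact.
have -> : cdf (X \+ Z : {RV P >-> R}) t = distribution P XZ [set z | z.1 + z.2 <= t].
  rewrite /cdf /distribution /pushforward; congr (P _).
(* By independence the joint law agrees with the product measure on rectangles, hence everywhere.
   The section at [x] of the half-plane is then the half-line up to [t - x]. *)
rewrite -(@product_measure_unique _ _ _ _ _ m1 m2)//; last first.
  move=> A B mA' mB; rewrite muleC -ZX// /XZ /distribution/pushforward/=; congr (P _).
  by apply/seteqP; split => w /= [].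
rewrite /product_measure1/=.
transitivity (\int[m1]_x (cdf Z (t - x)))%E.
  apply: eq_integral => x _; rewrite /cdf; congr (distribution P Z _).
  apply/seteqP; split => z /=; rewrite /xsection/= inE/= in_itv/= lerBrDl//.
rewrite ge0_integral_distribution//.
have h : measurable_fun setT (cdf Z \o (fun y : R => t - y)).
  apply: measurableT_comp; first exact: cdf_measurable.
  exact: measurable_funB.
exact: h.
Qed.

End independent_sum.

Section measure_preserving.
Context {d d'} {T : measurableType d} {T' : measurableType d'} {R : realType}.
Context {P : probability T R} {P' : probability T' R} (theta : {mfun T' >-> T}).

Lemma integral_measure_preserving (f : T -> \bar R) : measure_preserving P P' theta ->
  measurable_fun setT f -> (forall w, 0 <= f w)%E ->
  (\int[P']_w f (theta w) = \int[P]_w f w)%E.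
Proof.
move=> pres mf f0; rewrite -(ge0_integral_distribution theta mf f0).
by apply: eq_measure_integral => A mA _; exact: pres.
Qed.

End measure_preserving.

(** * Increments of a cdf with a density *)

Lemma integrable_scale {d} {T : measurableType d} {R : realType}
    (mu : {measure set T -> \bar R}) (D : set T) (f : T -> R) (c : R) :
  measurable D -> mu.-integrable D (EFin \o f) ->
  mu.-integrable D (EFin \o (fun x => c * f x)).
Proof.
move=> mD /(integrableZl mD c); apply: eq_integrable => // x _ /=.
Qed.

Lemma integrable_add {d} {T : measurableType d} {R : realType}
    (mu : {measure set T -> \bar R}) (D : set T) (f g : T -> R) :
  measurable D -> mu.-integrable D (EFin \o f) -> mu.-integrable D (EFin \o g) ->
  mu.-integrable D (EFin \o (fun x => f x + g x)).
Proof.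
by move=> mD fi gi; have := integrableD mD fi gi; apply: eq_integrable => // x _ /=.
Qed.

Lemma integrable_sub {d} {T : measurableType d} {R : realType}
    (mu : {measure set T -> \bar R}) (D : set T) (f g : T -> R) :
  measurable D -> mu.-integrable D (EFin \o f) -> mu.-integrable D (EFin \o g) ->
  mu.-integrable D (EFin \o (fun x => f x - g x)).
Proof.
by move=> mD fi gi; have := integrableB mD fi gi; apply: eq_integrable => // x _ /=.
Qed.

Section increments.
Context {R : realType}.
Implicit Types (a b l h : R) (p F : R -> R).
Let mu := @lebesgue_measure R.

Lemma density_cdf_increment (G : probability (measurableTypeR R) R) p a b :
  mu.-integrable setT (EFin \o p) ->
  (forall A, measurable A -> G A = (\int[mu]_(x in A) (p x)%:E)%E) -> a <= b ->
  fine (G `]-oo, b]%classic) - fine (G `]-oo, a]%classic) =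
  \int[mu]_(x in `]a, b]) p x.
Proof.
move=> ip Gp ab.
have Gfin A : measurable A -> G A \is a fin_num by move=> mA; rewrite fin_num_measure.
have -> : `]-oo, b]%classic = `]-oo, a]%classic `|` `]a, b]%classic :> set R.
  by rewrite -itv_bndbnd_setU.
rewrite measureU//=; last first.
  rewrite -subset0 => x/=; rewrite !in_itv/= => -[xa /andP[ax _]].
  by rewrite ltNge xa in ax.
by rewrite fineD ?Gfin// addrAC subrr add0r Gp.
Qed.

Lemma increment_bounds p F a b l h :
  mu.-integrable setT (EFin \o p) ->
  F b - F a = \int[mu]_(x in `]a, b]) p x -> a <= b ->
  (forall x, a <= x <= b -> l <= p x <= h) ->
  l * (b - a) <= F b - F a <= h * (b - a).
Proof.
move=> ip -> ab lph.
have lab : fine (mu `]a, b]%classic) = b - a.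
  rewrite /mu lebesgue_measure_itv/= lte_fin.
  by move: ab; rewrite le_eqVlt => /predU1P[->|->]//; rewrite ltxx subrr.
have ic c : mu.-integrable `]a, b] (EFin \o cst c).
  apply/integrableP; split; first exact/measurable_EFinP.
  rewrite /= integral_cst// lte_mul_pinfty// /mu/= lebesgue_measure_itv/= lte_fin.
  by case: ifP => // _; rewrite ltry.
have ip' : mu.-integrable `]a, b] (EFin \o p) by exact: integrableS ip.
rewrite -lab -!Rintegral_cst//; apply/andP; split.
  apply: le_Rintegral => //; [exact: ic|] => x /=; rewrite in_itv/= => /andP[ax xb].
  by have /andP[] := lph x (introT andP (conj (ltW ax) xb)).
apply: le_Rintegral => //; [exact: ic|] => x /=; rewrite in_itv/= => /andP[ax xb].
by have /andP[] := lph x (introT andP (conj (ltW ax) xb)).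
Qed.

Lemma mixture_cdf_increment (G H : probability (measurableTypeR R) R)
    (g q : R -> R) F (e a b : R) :
  mu.-integrable setT (EFin \o g) -> mu.-integrable setT (EFin \o q) ->
  (forall A, measurable A -> G A = (\int[mu]_(x in A) (g x)%:E)%E) ->
  (forall A, measurable A -> H A = (\int[mu]_(x in A) (q x)%:E)%E) ->
  (forall t, F t = (1 - e) * fine (G `]-oo, t]%classic)
                   + e * fine (H `]-oo, t]%classic)) ->
  a <= b ->
  F b - F a = \int[mu]_(x in `]a, b]) ((1 - e) * g x + e * q x).
Proof.
move=> ig iq Gg Hq FE ab.
have ig' : mu.-integrable `]a, b] (EFin \o g) by exact: integrableS ig.
have iq' : mu.-integrable `]a, b] (EFin \o q) by exact: integrableS iq.
have igZ c : mu.-integrable `]a, b] (EFin \o (fun x => c * g x)).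
  exact: integrable_scale.
have iqZ c : mu.-integrable `]a, b] (EFin \o (fun x => c * q x)).
  exact: integrable_scale.
rewrite RintegralD// !RintegralZl// -(density_cdf_increment G g)//.
rewrite -(density_cdf_increment H q)// !FE; ring.
Qed.

End increments.

(** * Lower bound for one increment of the cdf *)

Section pointwise.
Context {R : realType}.

(** Three regimes of [w = |x| + |y|]. If [w < A], the density is nearly [p t] and the error is
    [k * p t * w]. If [A <= w < |t| / 2], the density lies between 0 and [C * p t]; the increment is
    at least [- C * p t * w], and cancelling [p t * (x - y)] costs one more [p t * w]. Otherwise the
    increment is at least -1. *)
Lemma increment_lower_bound (p F : R -> R) (A k C t x y : R) :
  (forall a b l h, a <= b -> (forall z, a <= z <= b -> l <= p z <= h) ->
    l * (b - a) <= F b - F a <= h * (b - a)) ->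
  (forall z, 0 <= p z) -> (forall z, 0 <= F z <= 1) ->
  0 <= k -> 0 <= C ->
  (forall u, `|u| <= A -> `|p (t - u) - p t| <= k * p t) ->
  (forall u, `|u| <= `|t| / 2 -> p (t - u) <= C * p t) ->
  p t * (x - y) - k * p t * (`|x| + `|y|)
  - (1 + C) * p t * ((`|x| + `|y|) * (A <= `|x| + `|y|)%R%:R)
  - ((A <= `|x| + `|y|) && (`|t| / 2 <= `|x| + `|y|))%:R
  <= F (t - y) - F (t - x).
Proof.
move=> inc p0 F01 k0 C0 near half.
set w := `|x| + `|y|.
have xyw : - w <= x - y <= w.
  by rewrite -ler_norml (le_trans (ler_normB _ _)).
have xw : `|x| <= w by rewrite lerDl.
have yw : `|y| <= w by rewrite lerDr.
have w0 : 0 <= w by rewrite addr_ge0.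
(* Both endpoints lie within [w] of [t]. The sign of [x - y] decides which bound on the density
   limits the increment from below. *)
have bounds l h : (forall u, `|u| <= w -> l <= p (t - u) <= h) ->
    (y <= x -> l * (x - y) <= F (t - y) - F (t - x)) /\
    (x <= y -> h * (x - y) <= F (t - y) - F (t - x)).
  move=> plh.
  have plh' z : t - w <= z <= t + w -> l <= p z <= h.
    move=> /andP[z1 z2]; rewrite -(subKr t z); apply: plh.
    rewrite ler_norml; lra.
  move: xw yw; rewrite !ler_norml => /andP[x1 x2] /andP[y1 y2]; split => xy.
    have /andP[+ _] : l * ((t - y) - (t - x)) <= F (t - y) - F (t - x)
        <= h * ((t - y) - (t - x)).
      apply: inc => [|z /andP[z1 z2]]; [|apply: plh']; lra.
    by rewrite (_ : t - y - (t - x) = x - y); last ring.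
  have /andP[_] : l * ((t - x) - (t - y)) <= F (t - x) - F (t - y)
      <= h * ((t - x) - (t - y)).
    apply: inc => [|z /andP[z1 z2]]; [|apply: plh']; lra.
  rewrite (_ : t - x - (t - y) = y - x); last ring.
  lra.
have pt0 := p0 t; have ptw : 0 <= p t * w by rewrite mulr_ge0.
have kptw : 0 <= k * (p t * w) by rewrite mulr_ge0.
have Cptw : 0 <= C * (p t * w) by rewrite mulr_ge0.
have ptxy : p t * (x - y) <= p t * w by rewrite ler_wpM2l//; lra.
have [Aw|wA] := leP A w; last first.
  rewrite !mulr0 !subr0.
  have [|hl hh] := bounds ((1 - k) * p t) ((1 + k) * p t).
    by move=> u uw; have := near u (le_trans uw (ltW wA)); rewrite ler_norml; lra.
  have [yx|/ltW yx] := leP y x.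
    have := hl yx.
    have : k * (p t * (x - y)) <= k * (p t * w) by rewrite ler_wpM2l.
    lra.
  have := hh yx.
  have : k * (p t * (y - x)) <= k * (p t * w) by rewrite ler_wpM2l// ler_wpM2l//; lra.
  lra.
rewrite mulr1; have [tw|wt] := leP (`|t| / 2) w.
  have /andP[_ F1] := F01 (t - x); have /andP[F0 _] := F01 (t - y).
  rewrite mulr1n; lra.
have [|hl hh] := bounds 0 (C * p t).
  by move=> u uw; rewrite p0/=; exact: half (le_trans uw (ltW wt)).
rewrite subr0; have [yx|/ltW yx] := leP y x.
  have := hl yx; lra.
have := hh yx.
have : C * (p t * (y - x)) <= C * (p t * w) by rewrite ler_wpM2l// ler_wpM2l//; lra.
have : 0 <= p t * (y - x) by rewrite mulr_ge0// subr_ge0.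
lra.
Qed.

End pointwise.

(** * The heavy-tailed mixture *)

Section bounded_integrable.
Context {d} {T : measurableType d} {R : realType} {P : probability T R}.

Lemma Rintegral_cst_prob r : \int[P]_w r = r.
Proof.
transitivity (r * fine (1%E : \bar R)); last exact: mulr1.
by rewrite Rintegral_cst//; congr (_ * fine _); exact: probability_setT.
Qed.

Lemma bounded_integrable (f : T -> R) (K : R) : measurable_fun setT f ->
  (forall w, `|f w| <= K) -> P.-integrable setT (EFin \o f).
Proof.
move=> mf fK.
apply: (@le_integrable _ _ _ P _ measurableT _ (EFin \o cst K)).
- exact/measurable_EFinP.
- by move=> w _ /=; rewrite lee_fin (le_trans (fK w))// ler_norm.
- exact: finite_measure_integrable_cst.
Qed.

Lemma measurable_nat_of_bool (b : T -> bool) :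
  measurable [set w | b w] -> measurable_fun setT (fun w => (b w)%:R : R).
Proof.
move=> mb; rewrite (_ : (fun w => _) = \1_[set w | b w]); first exact: measurable_indic.
apply/funext => w; rewrite indicE; congr (nat_of_bool _)%:R.
by apply/idP/idP; rewrite inE.
Qed.

Lemma Rintegral_nat_of_bool (b : T -> bool) :
  measurable [set w | b w] -> \int[P]_w (b w)%:R = fine (P [set w | b w]).
Proof.
move=> mb; rewrite -[X in P X]setIT -(integral_indic _ measurableT mb).
congr fine; apply: eq_integral => w _; rewrite indicE; congr (nat_of_bool _)%:R%:E.
by apply/idP/idP; rewrite inE.
Qed.

Lemma measurable_le_set (W : T -> R) (a : R) : measurable_fun setT W ->
  measurable [set w | a <= W w].
Proof.
move=> mW; have -> : [set w | a <= W w] = W @^-1` `[a, +oo[.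
  by apply/seteqP; split => w /=; rewrite in_itv/= andbT.
by rewrite -[X in measurable X]setTI; exact: mW.
Qed.

Lemma integrable_nat_of_bool (b : T -> bool) :
  measurable [set w | b w] ->
  P.-integrable setT (EFin \o (fun w => (b w)%:R : R)).
Proof.
move=> mb; apply: (@bounded_integrable _ 1); first exact: measurable_nat_of_bool.
by move=> w; case: (b w); rewrite /= ?normr1 ?normr0.
Qed.

Lemma measurable_le2_set (W : T -> R) (a b : R) : measurable_fun setT W ->
  measurable [set w | (a <= W w) && (b <= W w)].
Proof.
move=> mW; have -> : [set w | (a <= W w) && (b <= W w)] =
    [set w | a <= W w] `&` [set w | b <= W w].
  by apply/seteqP; split => w /=; [move=> /andP|move=> [-> ->]].
by apply: measurableI; exact: measurable_le_set.
Qed.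

Lemma integrable_truncation (W : T -> R) (a : R) : measurable_fun setT W ->
  P.-integrable setT (EFin \o W) ->
  P.-integrable setT (EFin \o (fun w => W w * (a <= W w)%R%:R)).
Proof.
move=> mW iW.
apply: (@le_integrable _ _ _ P _ measurableT _ (EFin \o W)) => //.
- apply/measurable_EFinP; apply: measurable_funM => //.
  exact/measurable_nat_of_bool/measurable_le_set.
- move=> w _ /=; rewrite lee_fin normrM.
  by case: (a <= W w)%R; rewrite ?normr1 ?normr0 ?mulr1 ?mulr0.
Qed.

End bounded_integrable.
Arguments Rintegral_cst_prob {d T R} P r.

Section mixture.
Context {d} {T : measurableType d} {R : realType} {P : probability T R}.
Variables (W : T -> R) (B A M : R).
Hypotheses (mW : measurable_fun setT W) (W0 : forall w, 0 <= W w)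
  (iW : P.-integrable setT (EFin \o W)) (B0 : 0 < B) (M0 : 0 <= M).

Let c w : R := 1 + M * B * (A <= W w)%R%:R.

(** The scale is at least [B], so shifts up to [b * B] are small for every kernel of the mixture,
    and at least [W w], so the kernel is at least 1/9 at every [x] with [|x| / 2 <= W w]. *)
Let v w : R := B + W w.

Definition heavy_mixture x : R := \int[P]_w (c w * heavy_kernel (v w) x).

Let v0 w : 0 < v w. Proof. by rewrite ltr_pwDl. Qed.

Let c1 w : 1 <= c w.
Proof. by rewrite lerDl !mulr_ge0// ltW. Qed.

Let c0 w : 0 < c w. Proof. exact: lt_le_trans ltr01 (c1 w). Qed.

Let mc : measurable_fun setT c.
Proof.
apply: measurable_funD => //; apply: measurable_funM => //.
exact/measurable_nat_of_bool/measurable_le_set.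
Qed.

Let mv : measurable_fun setT v.
Proof. exact: measurable_funD. Qed.

Let ck_ge0 w x : 0 <= c w * heavy_kernel (v w) x.
Proof. by rewrite mulr_ge0 ?ltW// heavy_kernel_gt0. Qed.

Let ick x : P.-integrable setT (EFin \o (fun w => c w * heavy_kernel (v w) x)).
Proof.
apply: (@bounded_integrable _ _ _ _ _ (1 + M * B)).
  by apply: measurable_funM => //; exact: measurable_heavy_kernel.
move=> w; rewrite ger0_norm//.
have MB : 0 <= M * B by rewrite mulr_ge0// ltW.
rewrite -[leRHS]mulr1 ler_pM ?(ltW (c0 _)) ?(ltW (heavy_kernel_gt0 _ _ _))//; last first.
  exact: heavy_kernel_le1.
by rewrite lerD2l; case: (A <= W w)%R; rewrite ?mulr1 ?mulr0.
Qed.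

Lemma heavy_mixture_ge x : heavy_kernel B x <= heavy_mixture x.
Proof.
rewrite -[leLHS](Rintegral_cst_prob P).
apply: le_Rintegral => //; first exact: finite_measure_integrable_cst.
move=> w _; apply: (le_trans (le_heavy_kernel _ (v w) x B0 _)).
  by rewrite lerDl.
by rewrite ler_peMl// ltW// heavy_kernel_gt0.
Qed.

Lemma heavy_mixture_half x u : `|u| <= `|x| / 2 ->
  heavy_mixture (x - u) <= 4 * heavy_mixture x.
Proof.
move=> ux; rewrite -RintegralZl//; apply: le_Rintegral => //.
  exact: integrable_scale.
by move=> w _; rewrite [leRHS]mulrCA ler_wpM2l ?heavy_kernel_half// ltW.
Qed.

Lemma heavy_mixture_near x u b : 0 <= b -> b <= 1 -> `|u| <= b * B ->
  `|heavy_mixture (x - u) - heavy_mixture x| <= 3 * b * heavy_mixture x.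
Proof.
move=> b0 b1 ub.
have near w : `|heavy_kernel (v w) (x - u) - heavy_kernel (v w) x|
    <= 3 * b * heavy_kernel (v w) x.
  by apply: heavy_kernel_near => //; rewrite (le_trans ub)// ler_wpM2l// lerDl.
have up : heavy_mixture (x - u) <= (1 + 3 * b) * heavy_mixture x.
  rewrite -RintegralZl//; apply: le_Rintegral => //; first exact: integrable_scale.
  move=> w _; rewrite [leRHS]mulrCA ler_wpM2l ?(ltW (c0 _))//.
  have := near w; rewrite ler_norml; lra.
have lo : (1 - 3 * b) * heavy_mixture x <= heavy_mixture (x - u).
  rewrite -RintegralZl//; apply: le_Rintegral => //; first exact: integrable_scale.
  move=> w _; rewrite [leLHS]mulrCA ler_wpM2l ?(ltW (c0 _))//.
  have := near w; rewrite ler_norml; lra.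
rewrite ler_norml; lra.
Qed.

(** On the event the weight is at least [M * B] and the kernel at least 1/9. *)
Lemma heavy_mixture_tail t :
  M * B / 9 * fine (P [set w | (A <= W w) && (`|t| / 2 <= W w)])
  <= heavy_mixture t.
Proof.
have mS := measurable_le2_set _ A (`|t| / 2) mW.
have iS := integrable_nat_of_bool (P := P) _ mS.
rewrite -Rintegral_nat_of_bool// -RintegralZl//; apply: le_Rintegral => //.
  exact: integrable_scale.
move=> w _; have [/andP[Aw tw]|_] := boolP (_ && _); last by rewrite mulr0.
have MB : 0 <= M * B by rewrite mulr_ge0// ltW.
have K9 : 1 / 9 <= heavy_kernel (v w) t.
  apply: (heavy_kernel_far _ _ (v0 w)).
  by rewrite mulrC -ler_pdivrMr// (le_trans tw)// lerDr ltW.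
rewrite /c Aw !mulr1; nra.
Qed.

Let icv : P.-integrable setT (EFin \o (fun w => c w * v w)).
Proof.
have iv : P.-integrable setT (EFin \o v).
  by rewrite /v; apply: integrable_add => //; exact: finite_measure_integrable_cst.
apply: (@le_integrable _ _ _ P _ measurableT _
    (EFin \o (fun w => (1 + M * B) * v w))).
- by apply/measurable_EFinP; exact: measurable_funM.
- move=> w _ /=; have MB : 0 <= M * B by rewrite mulr_ge0// ltW.
  rewrite lee_fin !normrM ler_wpM2r// ger0_norm ?(ltW (c0 _))//.
  rewrite ger0_norm ?addr_ge0//.
  rewrite /c lerD2l.
  by case: (A <= W w)%R; rewrite ?mulr1 ?mulr0.
- exact: integrable_scale.
Qed.

Let K2 (z : R * T) : \bar R := (c z.2 * heavy_kernel (v z.2) z.1)%:E.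

Let mK2 : measurable_fun setT K2.
Proof.
apply/measurable_EFinP; apply: measurable_funM.
  exact: (measurableT_comp mc measurable_snd).
apply: measurable_heavy_kernel => //.
exact: (measurableT_comp mv measurable_snd).
Qed.

Let heavy_mixtureE x : (heavy_mixture x)%:E = (\int[P]_w K2 (x, w))%E.
Proof. by rewrite fineK//; exact: integrable_fin_num (ick x). Qed.

Lemma measurable_heavy_mixture : measurable_fun setT heavy_mixture.
Proof.
apply/measurable_EFinP.
apply: (eq_measurable_fun (fun x => \int[P]_w K2 (x, w))%E).
  by move=> x _; rewrite -heavy_mixtureE.
by apply: measurable_fun_fubini_tonelli_F => // z; rewrite lee_fin.
Qed.

(** Tonelli: the kernel at scale [v w] has mass [2 * v w]. *)
Lemma integral_heavy_mixture :
  (\int[lebesgue_measure]_x (heavy_mixture x)%:E = (2 * \int[P]_w (c w * v w))%:E)%E.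
Proof.
transitivity (\int[lebesgue_measure]_x \int[P]_w K2 (x, w))%E.
  by apply: eq_integral => x _; rewrite heavy_mixtureE.
rewrite (fubini_tonelli (m1 := lebesgue_measure) (m2 := P) K2)//=; last first.
  by move=> z; rewrite lee_fin.
transitivity (\int[P]_w (2 * (c w * v w))%:E)%E.
  apply: eq_integral => w _; rewrite /K2/=.
  under eq_integral do rewrite EFinM.
  rewrite ge0_integralZl_EFin//; last 3 first.
  - by move=> x _; rewrite lee_fin ltW// heavy_kernel_gt0.
  - by apply/measurable_EFinP; exact: measurable_heavy_kernel.
  - exact: ltW.
  by rewrite integral_heavy_kernel// -EFinM mulrCA.
rewrite -RintegralZl// fineK//.
by apply: integrable_fin_num => //; exact: integrable_scale.
Qed.

(** On the event [A <= W w] the relation [A = b * B] gives [B <= b^-1 * W w], so the scale [B + W w]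
    is at most [(1 + b^-1) * W w] and the additional mass is controlled by the truncated
    expectation. *)
Lemma heavy_mixture_mass_le b : 0 < b -> A = b * B ->
  \int[P]_w (c w * v w) <= B + \int[P]_w W w +
    M * B * (1 + b^-1) * \int[P]_w (W w * (A <= W w)%R%:R).
Proof.
move=> b0 Ab.
have iWA := integrable_truncation _ A mW iW.
have iB : P.-integrable setT (EFin \o cst B) by exact: finite_measure_integrable_cst.
have iBW : P.-integrable setT (EFin \o (fun w => B + W w)) by exact: integrable_add.
have -> : B + \int[P]_w W w = \int[P]_w (B + W w).
  by rewrite RintegralD// Rintegral_cst_prob.
rewrite -RintegralZl// -RintegralD//; last exact: integrable_scale.
apply: le_Rintegral => //.
  by apply: integrable_add => //; exact: integrable_scale.
move=> w _; rewrite /c /v; have [Aw|_] := boolP (A <= W w)%R; last first.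
  by rewrite !mulr0 !addr0 mul1r.
have MB : 0 <= M * B by rewrite mulr_ge0// ltW.
have BW : B <= b^-1 * W w by rewrite ler_pdivlMl// -Ab.
rewrite !mulr1; nra.
Qed.

End mixture.
Arguments heavy_mixture {d T R} P W B A M x.

(** * Uniform smallness of truncated expectations *)

Section tail.
Context {d} {T : measurableType d} {R : realType} {P : probability T R}.

Lemma integrable_tail_small (W : T -> R) (eta : R) :
  measurable_fun setT W -> (forall w, 0 <= W w) ->
  P.-integrable setT (EFin \o W) -> 0 < eta ->
  exists A0 : R, forall A, A0 <= A ->
    \int[P]_w (W w * (A <= W w)%R%:R) <= eta.
Proof.
move=> mW W0 iW eta0.
have mWA A : measurable_fun setT (fun w => W w * (A <= W w)%R%:R : R).
  apply: measurable_funM => //.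
  exact/measurable_nat_of_bool/measurable_le_set.
have WA_le A w : `|W w * (A <= W w)%R%:R| <= W w.
  rewrite normrM (ger0_norm (W0 w)).
  by case: (A <= W w)%R; rewrite ?normr1 ?normr0 ?mulr1 ?mulr0.
have iWA A := integrable_truncation _ A mW iW.
(* Dominated convergence along the integers: each truncated value is exactly 0 once [n] exceeds
   [W w]. Monotonicity in the threshold then covers all real [A]. *)
have cvg0 : (\int[P]_w ((W w * ((n%:R : R) <= W w)%R%:R)%:E))%E @[n --> \oo] --> 0%E.
  have -> : 0%E = (\int[P]_w cst 0 w)%E by rewrite integral_cst// mul0e.
  apply: (@dominated_cvg _ _ _ P _ measurableT
    (fun n w => (W w * ((n%:R : R) <= W w)%R%:R)%:E) _ (EFin \o W)) => //.
  - by move=> n; exact/measurable_EFinP.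
  - move=> w _; apply: cvg_near_cst; near=> n.
    rewrite (_ : (n%:R <= W w) = false) ?mulr0//.
    apply/negbTE; rewrite -ltNge; near: n; exact: nbhs_infty_gtr.
  - by move=> n w _ /=; rewrite lee_fin.
have [n _ /(_ n (leqnn n)) hn] := cvgr_lt 0 (fine_cvg cvg0) _ eta0.
exists n%:R => A nA; apply: le_trans (ltW hn); apply: le_Rintegral => //; [exact: iWA..|].
move=> w _; rewrite ler_wpM2l//; have [Aw|] := boolP (A <= W w)%R; last by rewrite ler0n.
by rewrite (le_trans nA Aw).
Unshelve. all: by end_near. Qed.

End tail.

(** * The smoothing distribution *)

Section smoothing.
Context {d} {T : measurableType d} {R : realType} {P : probability T R}.
Variables (W : T -> R) (eps m : R).
Hypotheses (mW : measurable_fun setT W) (W0 : forall w, 0 <= W w)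
  (iW : P.-integrable setT (EFin \o W))
  (eps0 : 0 < eps) (eps1 : eps < 1) (m0 : 0 < m).

(** Fixes all constants. The order of choice is [k], [C], [b], [M], [eta], [A0], [B]: the tolerance
    [eta] does not depend on [B], so [B] may be taken large afterwards. *)
Lemma smoothing_density : exists s q A k C,
  let p x := (1 - eps) * normal_pdf 0 s x + eps * q x in
  [/\ 0 < s, measurable_fun setT q, (forall x, 0 < q x),
     (\int[lebesgue_measure]_x (q x)%:E = 1)%E &
  [/\ 0 <= k, 0 <= C, k * (1 + \int[P]_w W w) <= m / 4 &
      (1 + C) * \int[P]_w (W w * (A <= W w)%R%:R) <= m / 4] /\
  [/\ forall t u, `|u| <= A -> `|p (t - u) - p t| <= k * p t,
      forall t u, `|u| <= `|t| / 2 -> p (t - u) <= C * p t &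
      forall t, fine (P [set w | (A <= W w) && (`|t| / 2 <= W w)]) <= k * p t] ].
Proof.
set EW := \int[P]_w W w.
have EW0 : 0 <= EW by apply: Rintegral_ge0.
pose k := Num.min 1 (m / 4 / (1 + EW)).
have k0 : 0 < k by rewrite lt_min ltr01/= !divr_gt0//; lra.
have k1 : k <= 1 by rewrite ge_min lexx.
have kE : k * (1 + EW) <= m / 4.
  by rewrite -ler_pdivlMr ?ge_min ?lexx ?orbT//; lra.
(* A shift by half multiplies the bounds by 4. The Gaussian part contributes [25 * 4 * 4 = 400], the
   last 4 coming from [qk], and the mixture 4; [eps] is the weight of [q] in [p]. *)
pose C := 404 / eps.
have C0 : 0 < C by apply: divr_gt0 eps0; rewrite ltr0n.
(* Relative variation: [100 * 4] from the Gaussian part and 3 from the mixture. *)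
pose b := k * eps / 403.
have b0 : 0 < b by apply: (divr_gt0 (mulr_gt0 k0 eps0)); rewrite ltr0n.
have b1 : b <= 1.
  have : k * eps <= 1 by rewrite mulr_ile1// ltW.
  by rewrite /b; lra.
(* The factor 36 is 9, from the lower bound 1/9 on the kernel, times 4, from the normalisation
   [2 * I <= 4 * B]. *)
pose M := 36 / (eps * k).
have M0 : 0 < M := divr_gt0 (ltr0Sn R 35) (mulr_gt0 eps0 k0).
have M0' := ltW M0.
have bV0 : 0 < b^-1 by rewrite invr_gt0.
pose L := M * (1 + b^-1).
have L0 : 0 < L by rewrite mulr_gt0// addr_gt0.
pose eta := Num.min (m / 4 / (1 + C)) ((2 * L)^-1).
(* The first term of [eta] serves the event [A <= W w]; the second keeps the additional mass of the
   mixture below [B / 2]. *)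
have eta0 : 0 < eta.
  rewrite lt_min invr_gt0 (mulr_gt0 (ltr0Sn R 1) L0) andbT.
  exact: divr_gt0 (divr_gt0 m0 (ltr0Sn R 3)) (addr_gt0 ltr01 C0).
have etaC : (1 + C) * eta <= m / 4.
  by rewrite mulrC -ler_pdivlMr ?ge_min ?lexx// addr_gt0.
have etaL : L * eta <= 1 / 2.
  rewrite mulrC -ler_pdivlMr// div1r -invfM ge_min lexx orbT//.
have [A0 hA0] := @integrable_tail_small _ _ _ P W eta mW W0 iW eta0.
(* The three terms ensure positivity, [EW <= B / 2], and [A0 <= b * B]. *)
pose B := 1 + 2 * EW + `|A0| / b.
have A0b : 0 <= `|A0| / b by rewrite divr_ge0// ltW.
have B0 : 0 < B by rewrite /B; lra.
pose A := b * B.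
have A0A : A0 <= A.
  rewrite (le_trans (ler_norm _))// /A /B mulrDr mulrCA divff ?gt_eqF// mulr1.
  by rewrite lerDr mulr_ge0 ?(ltW b0)//; lra.
have tau := hA0 A A0A; set tA := \int[P]_w _ in tau.
pose hm := heavy_mixture P W B A M.
pose I := \int[P]_w ((1 + M * B * (A <= W w)%R%:R) * (B + W w)).
(* The base weight contributes at most [B + B / 2], the additional weight at most [B / 2]. *)
have I2B : I <= 2 * B.
  have := heavy_mixture_mass_le W B A M mW iW B0 M0' b b0 erefl.
  rewrite -/I -/tA -/EW => /le_trans; apply.
  have : M * B * (1 + b^-1) * tA <= B * (L * eta).
    rewrite (_ : M * B * _ * _ = B * (L * tA)); last by rewrite /L; ring.
    by rewrite ler_wpM2l ?(ltW B0)// ler_wpM2l// ltW.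
  have : B * (L * eta) <= B * (1 / 2) by rewrite ler_wpM2l// ltW.
  have : EW <= B / 2 by rewrite /B; lra.
  lra.
have hm_ge x : heavy_kernel B x <= hm x by exact: heavy_mixture_ge.
have kB0 x : 0 < heavy_kernel B x by exact: heavy_kernel_gt0.
have hm0 x : 0 < hm x by exact: lt_le_trans (hm_ge x).
have mhm : measurable_fun setT hm by exact: measurable_heavy_mixture.
have intI : (\int[lebesgue_measure]_x (hm x)%:E = (2 * I)%:E)%E.
  exact: integral_heavy_mixture.
have BI : B <= I.
  suff : ((2 * B)%:E <= (2 * I)%:E)%E by rewrite lee_fin ler_pM2l.
  rewrite -intI -integral_heavy_kernel//; apply: ge0_le_integral => //.
  - by move=> x _; rewrite lee_fin ltW.
  - by apply/measurable_EFinP; exact: measurable_heavy_kernel.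
  - exact/measurable_EFinP.
  - by move=> x _; rewrite lee_fin.
have I0 : 0 < I := lt_le_trans B0 BI.
pose q x := (2 * I)^-1 * hm x.
have q0 x : 0 < q x by rewrite mulr_gt0// invr_gt0 mulr_gt0.
(* Since [I <= 2 * B], normalisation keeps [q] above a quarter of the kernel divided by [B]. The
   Gaussian bounds thus become bounds by [q]. *)
have qk x c : 0 <= c -> c / B * heavy_kernel B x <= 4 * c * q x.
  move=> c_ge0; rewrite /q.
  have h1 : B^-1 <= 4 * (2 * I)^-1.
    rewrite -[leLHS]mul1r ler_pdivrMr// mulrAC ler_pdivlMr ?mulr_gt0//; lra.
  rewrite -mulrA (_ : 4 * c * _ = c * (4 * (2 * I)^-1 * hm x)); last by ring.
  rewrite ler_wpM2l// ler_pM//; first by rewrite invr_ge0 ltW.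
  exact: ltW.
have q_half x u : `|u| <= `|x| / 2 -> q (x - u) <= 4 * q x.
  move=> ux; rewrite /q mulrCA ler_wpM2l ?invr_ge0 ?mulr_ge0 ?(ltW I0)//.
  exact: heavy_mixture_half.
have q_near x u : `|u| <= A -> `|q (x - u) - q x| <= 3 * b * q x.
  move=> uA; rewrite /q -mulrBr normrM ger0_norm ?invr_ge0 ?mulr_ge0 ?(ltW I0)//.
  rewrite mulrCA ler_wpM2l ?invr_ge0 ?mulr_ge0 ?(ltW I0)//.
  by apply: heavy_mixture_near => //; exact: ltW.
have mq : measurable_fun setT q by exact: measurable_funM.
have q1 : (\int[lebesgue_measure]_x (q x)%:E = 1)%E.
  under eq_integral do rewrite EFinM.
  rewrite ge0_integralZl_EFin//.
  - by rewrite intI -EFinM mulVf// gt_eqF// mulr_gt0.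
  - by move=> x _; rewrite lee_fin ltW.
  - exact/measurable_EFinP.
  - by rewrite invr_ge0 mulr_ge0// ltW.
have hq t : hm t = 2 * I * q t.
  by rewrite /q mulrA divff ?mul1r// gt_eqF// mulr_gt0.
clearbody q; have e10 : 0 <= 1 - eps by rewrite subr_ge0 ltW.
have e11 : 1 - eps <= 1 by rewrite gerBl ltW.
exists B, q, A, k, C; split=> //.
have ge_p x : eps * q x <= (1 - eps) * normal_pdf 0 B x + eps * q x.
  by rewrite lerDr mulr_ge0 ?normal_pdf_ge0.
split; split.
- exact: ltW.
- exact: ltW.
- exact: kE.
- by apply: le_trans etaC; rewrite ler_wpM2l// addr_ge0// ltW.
- move=> t u uA; apply: (@le_trans _ _ (k * (eps * q t))); last first.
    by rewrite ler_wpM2l ?ge_p// ltW.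
  have h1 : `|normal_pdf 0 B (t - u) - normal_pdf 0 B t| <= 400 * b * q t.
    have := normal_pdf_near B t u b B0 (ltW b0) b1 uA => /le_trans; apply.
    have : 0 <= 100 * b by rewrite mulr_ge0// ltW.
    move=> /(qk t); lra.
  have h2 := q_near t u uA.
  rewrite opprD addrACA -!mulrBr; apply: (le_trans (ler_normD _ _)).
  rewrite !normrM (gtr0_norm eps0) (ger0_norm e10).
  have h3 : (1 - eps) * `|normal_pdf 0 B (t - u) - normal_pdf 0 B t| <= 400 * b * q t.
    by apply: le_trans h1; rewrite ler_piMl.
  have h4 : eps * `|q (t - u) - q t| <= 3 * b * q t.
    by apply: le_trans h2; rewrite ler_piMl// ltW.
  apply: (le_trans (lerD h3 h4)).
  rewrite (_ : k * (eps * q t) = 403 * b * q t); first lra.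
  by rewrite /b; field.
- move=> t u ut; apply: (@le_trans _ _ (C * (eps * q t))); last first.
    by rewrite ler_wpM2l ?ge_p// ltW.
  have h1 : normal_pdf 0 B (t - u) <= 400 * q t.
    apply: (le_trans (normal_pdf_decay B (t - u) B0)).
    apply: (@le_trans _ _ (100 / B * heavy_kernel B t)).
      have := heavy_kernel_half B t u B0 ut.
      have : 0 <= 25 / B by rewrite divr_ge0// ltW.
      move=> h25 /(ler_wpM2l h25) /le_trans; apply; lra.
    have /(qk t) : 0 <= 100 :> R by []; lra.
  have h2 := q_half t u ut.
  have h3 : (1 - eps) * normal_pdf 0 B (t - u) <= 400 * q t.
    by apply: le_trans h1; rewrite ler_piMl ?normal_pdf_ge0.
  have h4 : eps * q (t - u) <= 4 * q t.
    by apply: le_trans h2; rewrite ler_piMl ?(ltW (q0 _))// ltW.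
  apply: (le_trans (lerD h3 h4)).
  rewrite (_ : C * (eps * q t) = 404 * q t); first lra.
  by rewrite /C; field; rewrite gt_eqF.
- move=> t; apply: (@le_trans _ _ (k * (eps * q t))); last first.
    by rewrite ler_wpM2l ?ge_p// ltW.
  have := @heavy_mixture_tail _ _ _ P W B A M mW W0 B0 M0' t; rewrite -/hm.
  set pr := fine (P _) => h.
  have h1 : hm t <= 4 * B * q t by rewrite hq ler_wpM2r ?(ltW (q0 _))//; lra.
  have h2 : M * pr <= 36 * q t.
    rewrite -(ler_pM2l (divr_gt0 B0 (ltr0n R 9))).
    rewrite (_ : B / 9 * (M * pr) = M * B / 9 * pr); last by ring.
    rewrite (_ : B / 9 * (36 * q t) = 4 * B * q t); last by field.
    exact: le_trans h h1.
  rewrite /M mulrAC ler_pdivrMr ?mulr_gt0// in h2; lra.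
Qed.

End smoothing.

(** * Strict inequality between the smoothed cdfs *)

Section gap.
Context {d} {T : measurableType d} {R : realType} {P : probability T R}.
Variables (X Y : T -> R) (p F : R -> R) (A k C : R).
Let W w := `|X w| + `|Y w|.
Hypotheses (mX : measurable_fun setT X) (mY : measurable_fun setT Y)
  (iX : P.-integrable setT (EFin \o X)) (iY : P.-integrable setT (EFin \o Y))
  (mF : measurable_fun setT F) (F01 : forall z, 0 <= F z <= 1)
  (inc : forall a b l h, a <= b -> (forall z, a <= z <= b -> l <= p z <= h) ->
    l * (b - a) <= F b - F a <= h * (b - a))
  (p0 : forall z, 0 < p z) (k0 : 0 <= k) (C0 : 0 <= C).

Let mW : measurable_fun setT W.
Proof. by apply: measurable_funD; exact: measurableT_comp. Qed.

Let iW : P.-integrable setT (EFin \o W).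
Proof.
apply: integrable_add => //.
  by have := integrable_norm iX.
by have := integrable_norm iY.
Qed.

Lemma integrable_cdf_shift (S : T -> R) t : measurable_fun setT S ->
  P.-integrable setT (EFin \o (fun w => F (t - S w))).
Proof.
move=> mS; apply: (@bounded_integrable _ _ _ _ _ 1).
  apply: (measurableT_comp mF); exact: measurable_funB.
by move=> w; have /andP[F0 F1] := F01 (t - S w); rewrite ger0_norm.
Qed.

(** Integrating [increment_lower_bound] leaves [m * p t] minus two losses of at most [m / 4 * p t]
    each. *)
Lemma smoothed_cdf_lt t :
  let m := \int[P]_w X w - \int[P]_w Y w in
  0 < m ->
  k * (1 + \int[P]_w W w) <= m / 4 ->
  (1 + C) * \int[P]_w (W w * (A <= W w)%R%:R) <= m / 4 ->
  (forall u, `|u| <= A -> `|p (t - u) - p t| <= k * p t) ->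
  (forall u, `|u| <= `|t| / 2 -> p (t - u) <= C * p t) ->
  fine (P [set w | (A <= W w) && (`|t| / 2 <= W w)]) <= k * p t ->
  \int[P]_w F (t - X w) < \int[P]_w F (t - Y w).
Proof.
move=> m m0 kE CE near half tail.
have pt0 := p0 t.
set tau := \int[P]_w _ in CE.
set EW := \int[P]_w _ in kE.
rewrite -subr_gt0 -RintegralB//; [|exact: integrable_cdf_shift..].
have mS := measurable_le2_set _ A (`|t| / 2) mW.
pose S w : R := ((A <= W w) && (`|t| / 2 <= W w))%:R.
have iS : P.-integrable setT (EFin \o S) := integrable_nat_of_bool _ mS.
have iWA := integrable_truncation _ A mW iW.
have iXY : P.-integrable setT (EFin \o (fun w => X w - Y w)).
  exact: integrable_sub.
pose L w := p t * (X w - Y w) - k * p t * W w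
  - (1 + C) * p t * (W w * (A <= W w)%R%:R) - S w.
have i1 := integrable_scale _ _ _ (p t) measurableT iXY.
have i2 := integrable_scale _ _ _ (k * p t) measurableT iW.
have i3 := integrable_scale _ _ _ ((1 + C) * p t) measurableT iWA.
have i4 := integrable_sub _ _ _ _ measurableT i1 i2.
have i5 := integrable_sub _ _ _ _ measurableT i4 i3.
have iL : P.-integrable setT (EFin \o L) := integrable_sub _ _ _ _ measurableT i5 iS.
apply: (@lt_le_trans _ _ (\int[P]_w L w)); last first.
  apply: le_Rintegral => //.
    by apply: integrable_sub => //; exact: integrable_cdf_shift.
  move=> w _; apply: increment_lower_bound => //.
  by move=> z; exact: ltW.
rewrite /L RintegralB// RintegralB// RintegralB// !RintegralZl// RintegralB//.
rewrite Rintegral_nat_of_bool// -/tau -/EW.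
(* The far tail costs at most [k * p t], which accounts for the summand 1 in [k * (1 + EW)]. *)
have h1 : k * p t * EW + k * p t <= m / 4 * p t by nra.
have h2 : (1 + C) * p t * tau <= m / 4 * p t by nra.
have h3 : 0 < m * p t by rewrite mulr_gt0.
rewrite -/m; lra.
Qed.

End gap.

(** * Strict dominance and conclusion *)

Section stochastic_order.
Context {d} {T : measurableType d} {R : realType} {P : probability T R}.

Lemma cdf_lt_stoch_gt (U V : {RV P >-> R}) :
  (forall t, cdf U t < cdf V t)%E -> stoch_gt P U V.
Proof.
move=> UV; split; first by apply: cdf_le_stoch_ge => t; exact/ltW.
move=> UVeq; have := UV 0; by rewrite /cdf UVeq ?ltxx.
Qed.

End stochastic_order.

Theorem mainTheorem3 (R : realType) (d : measure_display)
    (T : measurableType d) (P : probability T R) (X Y : {RV P >-> R})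
    (iX : P.-integrable setT (EFin \o X))
    (iY : P.-integrable setT (EFin \o Y))
    (EXY : ('E_P[Y] < 'E_P[X])%E)
    (eps : R) (eps_gt0 : 0 < eps) (eps_lt1 : eps < 1) :
  exists2 sigma : R, 0 < sigma &
  exists H : probability (measurableTypeR R) R,
  forall (d' : measure_display) (T' : measurableType d')
    (P' : probability T' R) (theta : {mfun T' >-> T})
    (Z : {RV P' >-> R}),
    measure_preserving P P' theta ->
    independent_RV P' Z (X \o theta) ->
    independent_RV P' Z (Y \o theta) ->
    (forall t : R,
      cdf Z t = ((1 - eps)%:E * normal_prob 0 sigma `]-oo, t]%classic
                 + eps%:E * H `]-oo, t]%classic)%E) ->
    stoch_gt P' ((X \o theta) \+ Z) ((Y \o theta) \+ Z).
Proof.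
pose W w := `|X w| + `|Y w|.
have mW : measurable_fun setT W by apply: measurable_funD; exact: measurableT_comp.
have W0 w : 0 <= W w by rewrite addr_ge0.
have iW : P.-integrable setT (EFin \o W).
  apply: integrable_add => //.
    by have := integrable_norm iX.
  by have := integrable_norm iY.
pose m := \int[P]_w X w - \int[P]_w Y w.
have m0 : 0 < m.
  move: EXY; rewrite !unlock subr_gt0 -lte_fin !fineK//.
  - exact: integrable_fin_num iX.
  - exact: integrable_fin_num iY.
have [s [q [A [k [C [s0 mq q0 q1 [[k0 C0 kE CE] [near half tail]]]]]]]] :=
  smoothing_density W eps m mW W0 iW eps_gt0 eps_lt1 m0.
exists s => //.
have [H Hq] := density_probability q mq (fun x => ltW (q0 x)) q1.
(* The scale [s] and the law [H] are fixed on the original space, before any extension or [Z] is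
   given. *)
exists H => d' T' P' theta Z pres ZX ZY FZ.
pose F t := fine (cdf Z t).
have cdfF t : cdf Z t = (F t)%:E by rewrite fineK// fin_num_measure.
pose p x := (1 - eps) * normal_pdf 0 s x + eps * q x.
have p0 x : 0 < p x.
  by rewrite ltr_wpDl ?mulr_gt0// mulr_ge0 ?normal_pdf_ge0// subr_ge0 ltW.
have ig : lebesgue_measure.-integrable setT (EFin \o normal_pdf 0 s).
  exact: integrable_normal_pdf.
have iq : lebesgue_measure.-integrable setT (EFin \o q).
  apply/integrableP; split; first exact/measurable_EFinP.
  under eq_integral do rewrite /= gtr0_norm//.
  by rewrite q1 ltry.
have ip : lebesgue_measure.-integrable setT (EFin \o p).
  by apply: integrable_add => //; exact: integrable_scale.
have FE t : F t = (1 - eps) * fine (normal_prob 0 s `]-oo, t]%classic)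
    + eps * fine (H `]-oo, t]%classic).
  rewrite /F FZ fineD ?fineM// ?fin_numM//; exact: fin_num_measure.
have inc a b l h : a <= b -> (forall z, a <= z <= b -> l <= p z <= h) ->
    l * (b - a) <= F b - F a <= h * (b - a).
  move=> ab; apply: (increment_bounds p) => //.
  exact: (mixture_cdf_increment (normal_prob 0 s) H).
have F01 z : 0 <= F z <= 1.
  by rewrite -!lee_fin -cdfF cdf_ge0 cdf_le1.
have mF : measurable_fun setT F.
  apply/measurable_EFinP; apply: (eq_measurable_fun (cdf Z)) => [t _|].
    exact: cdfF.
  exact: cdf_measurable.
(* The convolution formula holds on the extension; since [theta] preserves measure, the integral
   returns to [T], where the estimates were made. *)
have cdf_sum (S : {RV P >-> R}) t : independent_RV P' Z (S \o theta) ->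
    cdf ((S \o theta) \+ Z : {RV P' >-> R}) t = (\int[P]_w F (t - S w))%:E.
  move=> ZS; rewrite cdf_independent_add//.
  under eq_integral do rewrite cdfF.
  rewrite (integral_measure_preserving theta (fun w => (F (t - S w))%:E) pres).
  - rewrite fineK//; apply: integrable_fin_num => //.
    exact: (integrable_cdf_shift F mF F01).
  - apply/measurable_EFinP; apply: (measurableT_comp mF).
    exact: measurable_funB.
  - by move=> w; rewrite lee_fin; have /andP[] := F01 (t - S w).
apply: cdf_lt_stoch_gt => t; rewrite !cdf_sum// lte_fin.
apply: (smoothed_cdf_lt X Y p F A k C) => //.
- by move=> u; exact: near.
- by move=> u; exact: half.
Qed.
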